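(* Let $(M,\mathcal F,g_\intercal)$ be a transversely time-oriented Lorentzian foliation. If $(M,\mathcal F,g_\intercal)$ is transversely stably causal, then it admits a function $f:M\to\mathbb R$ which is almost everywhere continuous and strictly increases along every future-directed transversely causal curve.
   Context: $M$ is a connected smooth manifold of dimension $n\ge 3$. $\mathcal F$ is a regular foliation of codimension $q\geq 2$: a partition of $M$ into connected immersed submanifolds (leaves), locally given by the fibers of a submersion. $T\mathcal F\subset TM$ is the (vertical) distribution tangent to the leaves; vectors in $T\mathcal F$, and vector fields with values in it, are called vertical. A transverse Lorentzian metric on $(M,\mathcal F)$ is a smooth symmetric $(0,2)$-tensor field $g_\intercal$ on $M$ with $\mathcal L_Vg_\intercal=0$ for all vertical $V$, such that at each $x$ the bilinear form $g_\intercal(x)$ has index $1$ and its kernel is exactly $T_x\mathcal F$. $\mathcal{TL}(M,\mathcal F)$ is the set of these. The triple $(M,\mathcal F,g_\intercal)$ is then called a Lorentzian foliation. A nonvertical vector $v$ is transversely timelike if $g_\intercal(v,v)<0$ and transversely causal if $g_\intercal(v,v)\le 0$. The set of transversely causal vectors at $x$ has two connected components (causal wedges); a transverse time orientation is a continuous choice of one of them (the future causal wedge) at each point. A future-directed transversely causal (timelike) curve is a piecewise smooth curve whose tangent vectors are transversely causal (timelike) and lie in the future causal wedges. For leaves $L,L'$, write $L<_{M/\mathcal F}L'$ if there is a future-directed transversely causal curve from a point of $L$ to a point of $L'$. $(M,\mathcal F,g_\intercal)$ is transversely causal if $L\nless_{M/\mathcal F}L$ for every leaf $L$. For $g_\intercal,g'_\intercal\in\mathcal{TL}(M,\mathcal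 F)$, write $g_\intercal<g'_\intercal$ if for every $v\in TM\setminus T\mathcal F$, $g_\intercal(v,v)\le0\Rightarrow g'_\intercal(v,v)<0$; in that case $g'_\intercal$ is time-oriented so that its future wedges contain those of $g_\intercal$. $(M,\mathcal F,g_\intercal)$ is transversely stably causal if there is $g'_\intercal\in\mathcal{TL}(M,\mathcal F)$ with $g_\intercal<g'_\intercal$ and $(M,\mathcal F,g'_\intercal)$ transversely causal. ''Almost everywhere continuous'' means continuous apart from a set of measure zero, where measure zero is in the usual sense on a smooth manifold (Lebesgue-null in charts). ''Strictly increases along a curve $\alpha$'' means $t<s\Rightarrow f(\alpha(t))<f(\alpha(s))$. *)

(* Defs.v *)
From HB Require Import structures.
From mathcomp Require Import all_boot all_order all_algebra.
From mathcomp Require Import all_classical all_reals all_analysis.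
Import Order.TTheory GRing.Theory Num.Theory.
Import numFieldNormedType.Exports.

Set Implicit Arguments.
Unset Strict Implicit.
Unset Printing Implicit Defensive.

Local Open Scope classical_set_scope.
Local Open Scope ring_scope.

(* C^k maps on an open subset [U] of a finite-dimensional space: the Frechet
   differential exists and all x |-> Df(x)v are C^(k-1). The values of [f]
   outside [U] are irrelevant. *)
Fixpoint Ck (R : realType) (V W : normedModType R) (k : nat) (U : set V)
    (f : V -> W) : Prop :=
  match k with
  | 0 => forall x, U x -> {for x, continuous f}
  | k'.+1 => (forall x, U x -> differentiable f x) /\
             (forall v : V, Ck k' U ('D_v f))
  end.

Definition smooth_on (R : realType) (V W : normedModType R) (U : set V)
  (f : V -> W) : Prop := forall k, Ck k U f.

(* The inverse [cinv] is a total function, meaningful on the image only. *)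
Record chart (R : realType) (n : nat) (M : topologicalType) := Chart {
  cdom : set M;
  cmap : M -> 'rV[R]_n;
  cinv : 'rV[R]_n -> M;
  cdom_open : open cdom;
  cimg_open : open (cmap @` cdom);
  cmapK : forall x, cdom x -> cinv (cmap x) = x;
  cmap_continuous : forall x, cdom x -> {for x, continuous cmap};
  cinv_continuous : forall z, (cmap @` cdom) z -> {for z, continuous cinv} }.

(* The tangent space at [x] is identified with 'rV[R]_n through the preferred
   chart [chart_at x]: a vector of T_xM is represented by its components in
   that chart. All linear maps act on row vectors by right multiplication. *)
Record manifold (R : realType) (n : nat) (M : topologicalType) := Manifold {
  atlas : set (chart R n M);
  chart_at : M -> chart R n M;
  chart_at_atlas : forall x, atlas (chart_at x);
  chart_at_dom : forall x, cdom (chart_at x) x;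
  atlas_smooth : forall c d, atlas c -> atlas d ->
    smooth_on (cmap c @` (cdom c `&` cdom d)) (cmap d \o cinv c);
  manifold_hausdorff : hausdorff_space M;
  manifold_second_countable : @second_countable M }.

Section Manifolds.
Variables (R : realType) (n : nat) (M : topologicalType) (A : manifold R n M).

Definition smooth_map (m : nat) (N : topologicalType) (B : manifold R m N)
    (f : M -> N) : Prop :=
  continuous f /\
  forall c d, atlas A c -> atlas B d ->
    smooth_on (cmap c @` (cdom c `&` f @^-1` cdom d)) (cmap d \o f \o cinv c).

Definition differential (m : nat) (N : topologicalType) (B : manifold R m N)
    (f : M -> N) (x : M) : 'M[R]_(n, m) :=
  'J (cmap (chart_at B (f x)) \o f \o cinv (chart_at A x))
     (cmap (chart_at A x) x).

Definition submersion_on (q : nat) (U : set M) (s : M -> 'rV[R]_q) : Prop :=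
  (forall c, atlas A c ->
     smooth_on (cmap c @` (cdom c `&` U)) (s \o cinv c)) /\
  (forall x, U x ->
     row_full ('J (s \o cinv (chart_at A x)) (cmap (chart_at A x) x))).

(* Component functions in the chart [c], on the image of [c]. *)
Definition vector_in (c : chart R n M) (X : M -> 'rV[R]_n) (z : 'rV[R]_n) :
    'rV[R]_n :=
  let x := cinv c z in
  X x *m 'J (cmap c \o cinv (chart_at A x)) (cmap (chart_at A x) x).

Definition tensor_in (c : chart R n M) (g : M -> 'M[R]_n) (z : 'rV[R]_n) :
    'M[R]_n :=
  let x := cinv c z in
  let K := 'J (cmap (chart_at A x) \o cinv c) z in
  K *m g x *m K^T.

Definition smooth_vector_field (X : M -> 'rV[R]_n) : Prop :=
  forall c, atlas A c -> smooth_on (cmap c @` cdom c) (vector_in c X).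

Definition continuous_vector_field_on (U : set M) (X : M -> 'rV[R]_n) : Prop :=
  forall c, atlas A c -> forall z, (cmap c @` (cdom c `&` U)) z ->
    {for z, continuous (vector_in c X)}.

Definition smooth_tensor_field (g : M -> 'M[R]_n) : Prop :=
  forall c, atlas A c -> smooth_on (cmap c @` cdom c) (tensor_in c g).

(* (L_V g)_ab = V^c d_c g_ab + (d_a V^c) g_cb + g_ac (d_b V^c) *)
Definition lie_derivative_in (c : chart R n M) (V : M -> 'rV[R]_n)
    (g : M -> 'M[R]_n) (z : 'rV[R]_n) : 'M[R]_n :=
  let v := vector_in c V in
  let G := tensor_in c g in
  'D_(v z) G z + 'J v z *m G z + G z *m ('J v z)^T.

Definition lie_invariant (V : M -> 'rV[R]_n) (g : M -> 'M[R]_n) : Prop :=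
  forall c, atlas A c -> forall z, (cmap c @` cdom c) z ->
    lie_derivative_in c V g z = 0.

Definition velocity (al : R -> M) (t : R) : 'rV[R]_n :=
  'D_1 (cmap (chart_at A (al t)) \o al) t.

Definition smooth_curve_on (W : set R) (al : R -> M) : Prop :=
  [/\ open W, forall t, W t -> {for t, continuous al} &
      forall c, atlas A c ->
        smooth_on (W `&` al @^-1` cdom c) (cmap c \o al)].

End Manifolds.

Definition box_volume (R : realType) (n : nat) (a b : 'rV[R]_n) : R :=
  \prod_(i < n) (b 0 i - a 0 i).

Definition lebesgue_null (R : realType) (n : nat) (Z : set 'rV[R]_n) : Prop :=
  forall e : R, 0 < e -> exists a b : nat -> 'rV[R]_n,
    [/\ forall k i, a k 0 i <= b k 0 i,
        Z `<=` \bigcup_k [set x : 'rV[R]_n | forall i, a k 0 i <= x 0 i <= b k 0 i] &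
        (\sum_(0 <= k <oo) (box_volume (a k) (b k))%:E <= e%:E)%E].

Definition measure_zero (R : realType) (n : nat) (M : topologicalType)
    (A : manifold R n M) (Z : set M) : Prop :=
  forall c, atlas A c -> lebesgue_null (cmap c @` (cdom c `&` Z)).

Definition ae_continuous (R : realType) (n : nat) (M : topologicalType)
    (A : manifold R n M) (f : M -> R) : Prop :=
  measure_zero A [set x | ~ {for x, continuous f}].

(* The leaves are the images of injective immersions [leaf_incl], so that they
   carry their own (leaf) topology. The last field says that [M] is covered by
   open sets [U] on which the plaques, i.e. the connected components of the
   intersections of the leaves with [U] in the leaf topology, are the fibers of
   a submersion. *)
Record foliation (R : realType) (n : nat) (M : topologicalType)
    (A : manifold R n M) (q : nat) := Foliation {
  leaf_index : Type;
  leaf : leaf_index -> topologicalType;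
  leaf_manifold : forall l, manifold R (n - q) (leaf l);
  leaf_incl : forall l, leaf l -> M;
  leaf_nonempty : forall l, exists y : leaf l, True;
  leaf_connected : forall l, connected [set: leaf l];
  leaf_smooth : forall l, smooth_map (leaf_manifold l) A (@leaf_incl l);
  leaf_immersion : forall l (y : leaf l),
    row_free (differential (leaf_manifold l) A (@leaf_incl l) y);
  leaf_partition : forall x,
    exists! p : {l : leaf_index & leaf l}, leaf_incl (projT2 p) = x;
  leaf_locally_fiber : forall x, exists (U : set M) (s : M -> 'rV[R]_q),
    [/\ open U, U x, submersion_on A U s &
        forall l (y : leaf l), U (leaf_incl y) ->
          @leaf_incl l @` connected_component (@leaf_incl l @^-1` U) y =
          U `&` [set x' | s x' = s (leaf_incl y)]] }.

Section BilinearForms.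
Variables (R : realType) (n : nat).
Implicit Types B W : 'M[R]_n.

Definition bform B (u v : 'rV[R]_n) : R := (u *m B *m v^T) 0 0.

(* Subspaces are represented by the row spaces of square matrices. *)
Definition negative_definite_on B W : Prop :=
  forall v : 'rV[R]_n, (v <= W)%MS -> v != 0 -> bform B v v < 0.

Definition has_index B (k : nat) : Prop :=
  (exists2 W : 'M[R]_n, negative_definite_on B W & \rank W = k) /\
  (forall W : 'M[R]_n, negative_definite_on B W -> (\rank W <= k)%N).

End BilinearForms.

Section LorentzianFoliations.
Variables (R : realType) (n q : nat) (M : topologicalType).
Variables (A : manifold R n M) (F : foliation A q).
Implicit Types (g : M -> 'M[R]_n) (fut : M -> set 'rV[R]_n).

Definition vertical (x : M) (v : 'rV[R]_n) : Prop :=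
  exists (l : leaf_index F) (y : leaf l) (w : 'rV[R]_(n - q)),
    leaf_incl y = x /\
    v = w *m differential (leaf_manifold l) A (@leaf_incl _ _ _ _ _ F l) y.

Definition transverse_lorentzian g : Prop :=
  [/\ smooth_tensor_field A g,
      forall x, (g x)^T = g x,
      forall V, smooth_vector_field A V -> (forall x, vertical x (V x)) ->
        lie_invariant A V g,
      forall x, has_index (g x) 1 &
      forall x v, vertical x v <-> (forall w, bform (g x) v w = 0)].

Definition transversely_causal_vector g (x : M) : set 'rV[R]_n :=
  [set v | ~ vertical x v /\ bform (g x) v v <= 0].

(* [fut x] is the future causal wedge at [x]; continuity of the choice means
   that it is locally selected by continuous vector fields. *)
Definition time_orientation g fut : Prop :=
  (forall x, exists2 v, transversely_causal_vector g x v &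
     fut x = connected_component (transversely_causal_vector g x) v) /\
  (forall x, exists (U : set M) (X : M -> 'rV[R]_n),
     [/\ open U, U x, continuous_vector_field_on A U X &
         forall y, U y -> fut y (X y)]).

(* Smoothness on [a, b] means that there is a smooth extension to an open set
   of parameters; the velocities at a and b are the one-sided ones. *)
Definition future_causal_arc fut (al : R -> M) (a b : R) : Prop :=
  a < b /\ exists (W : set R) (be : R -> M),
    [/\ `[a, b]%classic `<=` W, smooth_curve_on A W be,
        forall t, a <= t <= b -> be t = al t &
        forall t, a <= t <= b -> fut (be t) (velocity A be t)].

Inductive future_causal_path fut (al : R -> M) : R -> R -> Prop :=
| Path_arc a b : future_causal_arc fut al a b -> future_causal_path fut al a b
| Path_cat a b c : future_causal_arc fut al a b ->
    future_causal_path fut al b c -> future_causal_path fut al a c.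

(* Future-directed transversely causal curves defined on an interval [J] of
   any kind: piecewise smooth on every compact subinterval. *)
Definition future_causal_curve fut (J : set R) (al : R -> M) : Prop :=
  is_interval J /\
  forall a b, J a -> J b -> a < b -> future_causal_path fut al a b.

Definition leaf_lt fut (l l' : leaf_index F) : Prop :=
  exists (al : R -> M) (a b : R) (y : leaf l) (y' : leaf l'),
    [/\ a < b, future_causal_curve fut `[a, b]%classic al,
        al a = leaf_incl y & al b = leaf_incl y'].

Definition transversely_causal fut : Prop := forall l, ~ leaf_lt fut l l.

Definition metric_lt g g' : Prop :=
  forall x v, ~ vertical x v -> bform (g x) v v <= 0 -> bform (g' x) v v < 0.

Definition transversely_stably_causal g fut : Prop :=
  exists g' fut',
    [/\ transverse_lorentzian g', metric_lt g g', time_orientation g' fut',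
        forall x, fut x `<=` fut' x & transversely_causal fut'].

End LorentzianFoliations.

(* Main.v *)
Require Import Defs.
From HB Require Import structures.
From mathcomp Require Import all_boot all_order all_algebra.
From mathcomp Require Import all_classical all_reals all_analysis.
From mathcomp Require Import ring lra.
Import Order.TTheory GRing.Theory Num.Theory.
Import numFieldNormedType.Exports.

Local Open Scope classical_set_scope.
Local Open Scope ring_scope.

(* Let g' be a wider transversely causal metric and (B_k) a countable basis of
   M. The function is f = sum_k 2^-k 1_(P_k), where P_k is the set of points
   reached by a future g'-causal path from a point of B_k; the leaves only
   matter in that no point is reached from itself. f is nondecreasing along
   causal curves, and a g-causal curve from x to y is g'-timelike, so some B_k
   lies both in the g'-future of x and in the g'-past of y; then y is in P_k,
   and x is not, for otherwise a point of B_k would be reached from itself.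

   f is continuous off the frontiers of the P_k. In a chart, the difference of
   two points of a frontier locally avoids a fixed open cone. Hence, when a
   cube is cut into N^n equal cubes with N large, one of them misses the
   frontier: two of the small cubes have all their differences in the cone.
   Iterating, the frontier has measure zero. *)

(** * Lorentzian forms *)

Section Forms.
Context {R : realType} {n : nat}.
Implicit Types (B : 'M[R]_n) (u v w : 'rV[R]_n).

Lemma bformDl B u v w : bform B (u + v) w = bform B u w + bform B v w.
Proof. by rewrite /bform !mulmxDl mxE. Qed.

Lemma bformZl B a u w : bform B (a *: u) w = a * bform B u w.
Proof. by rewrite /bform -!scalemxAl mxE. Qed.

Lemma bformDr B u v w : bform B w (u + v) = bform B w u + bform B w v.
Proof. by rewrite /bform linearD mulmxDr mxE. Qed.

Lemma bformZr B a u w : bform B w (a *: u) = a * bform B w u.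
Proof. by rewrite /bform linearZ -scalemxAr mxE. Qed.

Lemma bformC B u v : B^T = B -> bform B u v = bform B v u.
Proof.
move=> BT; rewrite /bform -[in RHS]BT.
by rewrite -[in LHS](trmxK (u *m B *m v^T)) mxE !trmx_mul trmxK mulmxA.
Qed.

Lemma bform_pullback B (K : 'M[R]_n) u v :
  bform (K *m B *m K^T) u v = bform B (u *m K) (v *m K).
Proof. by rewrite /bform trmx_mul !mulmxA. Qed.

(** Two such vectors would span a negative definite plane, which index 1 forbids. *)
Lemma orthogonal_timelike_absurd B u w : B^T = B -> has_index B 1 ->
  bform B u u < 0 -> bform B w w < 0 -> bform B u w <> 0.
Proof.
move=> BT [_ maxB] uu ww uw.
have indep a : w <> a *: u.
  move=> wE; move: uw ww; rewrite wE bformZr => /eqP.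
  by rewrite mulf_eq0 (lt_eqF uu) orbF => /eqP ->; rewrite bformZl mul0r ltxx.
have neg : negative_definite_on B (u + w)%MS.
  move=> v /sub_addsmxP[[a b] /= ->].
  rewrite (mx11_scalar a) (mx11_scalar b) !mul_scalar_mx.
  move: (a 0 0) (b 0 0) => {}a {}b nz.
  rewrite !(bformDl, bformDr, bformZl, bformZr) (bformC _ w u)// uw.
  rewrite !mulr0 addr0 add0r.
  have [a0|a0] := eqVneq a 0.
    have b0 : b != 0.
      by apply: contra_neq nz => b0; rewrite a0 b0 !scale0r addr0.
    have : 0 < b ^+ 2 by rewrite exprn_even_gt0.
    rewrite a0; nra.
  have : 0 < a ^+ 2 by rewrite exprn_even_gt0.
  have : 0 <= b ^+ 2 by exact: sqr_ge0.
  nra.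
have rk := maxB _ neg.
have u0 : u != 0.
  by apply/eqP => u0; move: uu; rewrite u0 -(scale0r 0) bformZl mul0r ltxx.
have rku : \rank u = 1%N by rewrite rank_rV u0.
have le_u : (u <= u + w)%MS by exact: addsmxSl.
have : (u + w <= u)%MS.
  by rewrite -(geq_leqif (mxrank_leqif_sup le_u)) rku.
move=> /(submx_trans (addsmxSr u w)) /sub_rVP[a wE].
exact: (indep a).
Qed.

(** The new case is a null [w], which pairs nontrivially with some [z]. If [w] were orthogonal to
    [u], removing from [z] its component along [u] would give [y] with the same pairing, and some
    [w + s *: y] would be timelike and still orthogonal to [u]. *)
Lemma bform_timelike_neq0 B u w : B^T = B -> has_index B 1 ->
  bform B u u < 0 -> bform B w w <= 0 -> ~ (forall z, bform B w z = 0) ->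
  bform B u w <> 0.
Proof.
move=> BT ind uu; rewrite le_eqVlt => /predU1P[ww|ww _]; last first.
  exact: orthogonal_timelike_absurd.
move=> /existsNP[z /eqP wz] uw.
pose y := z + (- (bform B u z / bform B u u)) *: u.
have uy : bform B u y = 0.
  by rewrite /y bformDr bformZr mulNr divfK ?subrr// lt_eqF.
have wy : bform B w y = bform B w z.
  by rewrite /y bformDr bformZr (bformC _ w u)// uw mulr0 addr0.
clearbody y.
have [s sneg] : exists s, bform B (w + s *: y) (w + s *: y) < 0.
  set c := bform B w z in wz wy; set d := bform B y y.
  have E s : bform B (w + s *: y) (w + s *: y) = 2 * s * c + s ^+ 2 * d.
    rewrite !(bformDl, bformDr, bformZl, bformZr) ww (bformC _ y w)// wy -/d.
    by ring.
  have c2 : 0 < c ^+ 2 by rewrite exprn_even_gt0.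
  have d1 : 0 < 1 + `|d| by rewrite ltr_pwDl.
  have dd : d <= `|d| by exact: ler_norm.
  (* This sign of [s] makes the linear term [2 * s * c] negative, and the denominator keeps
     [s ^+ 2 * d] smaller than it in size. *)
  exists (- c / (1 + `|d|)); rewrite E.
  have -> : 2 * (- c / (1 + `|d|)) * c + (- c / (1 + `|d|)) ^+ 2 * d =
    (c ^+ 2 / (1 + `|d|) ^+ 2) * (d - 2 * (1 + `|d|)).
    by field; rewrite gt_eqF.
  rewrite pmulr_rlt0; last by rewrite divr_gt0// exprn_gt0.
  by have := normr_ge0 d; lra.
apply: (orthogonal_timelike_absurd B u _ BT ind uu sneg).
by rewrite bformDr bformZr uw uy mulr0 addr0.
Qed.

Lemma cvg_bform {T : Type} {F : set_system T} {FF : Filter F}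
    (G : T -> 'M[R]_n) (u v : T -> 'rV[R]_n) B u0 v0 :
  G @ F --> B -> u @ F --> u0 -> v @ F --> v0 ->
  (fun t => bform (G t) (u t) (v t)) @ F --> bform B u0 v0.
Proof.
move=> cG cu cv.
have E C w y : bform C w y = \sum_i (\sum_j w 0 j * C j i) * y 0 i.
  by rewrite /bform mxE; apply: eq_bigr => i _; rewrite !mxE.
rewrite E; under eq_fun do rewrite E.
apply: cvg_big => [|i _]; first exact: add_continuous.
apply: cvgM.
  apply: cvg_big => [|j _]; first exact: add_continuous.
  apply: cvgM.
    exact: (continuous_cvg _ (@coord_continuous _ _ _ 0 j _) cu).
  exact: (continuous_cvg _ (@coord_continuous _ _ _ j i _) cG).
exact: (continuous_cvg _ (@coord_continuous _ _ _ 0 i _) cv).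
Qed.

(** Along the segment from [u] to [w] the form is a sum of nonpositive terms, with negative total
    before the end [w]. A vector of negative square lies outside the kernel, so the whole segment is
    causal. *)
Lemma causal_segment_connected B u w : B^T = B ->
  bform B u u < 0 -> bform B w w <= 0 -> ~ (forall z, bform B w z = 0) ->
  bform B u w < 0 ->
  connected_component
    [set v | ~ (forall z, bform B v z = 0) /\ bform B v v <= 0] w u.
Proof.
move=> BT uu ww wk uw.
pose p (t : R) := u + t *: (w - u).
have cp : continuous p.
  move=> t; apply: cvgD; first exact: cvg_cst.
  by apply: cvgZl; exact: cvg_id.
exists (p @` `[0, 1]%classic); last first.
  by exists 0; rewrite /p ?scale0r ?addr0//= in_itv/= lexx ler01.
split.
- by exists 1; rewrite /p ?scale1r 1?addrC ?subrK//= in_itv/= lexx ler01.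
- move=> _ [t /= + <-]; rewrite in_itv/= => /andP[t0 t1].
  have [->|tn1] := eqVneq t 1.
    by rewrite /p scale1r [u + _]addrC subrK.
  have {}t1 : t < 1 by rewrite lt_neqAle tn1.
  have neg : bform B (p t) (p t) < 0.
    have -> : p t = (1 - t) *: u + t *: w.
      by rewrite /p scalerBr scalerBl scale1r addrCA addrC.
    rewrite !(bformDl, bformDr, bformZl, bformZr) (bformC _ w u)//.
    have t1' : 0 < 1 - t by rewrite subr_gt0.
    have : (1 - t) * ((1 - t) * bform B u u) < 0.
      by rewrite pmulr_rlt0// pmulr_rlt0.
    have : (1 - t) * (t * bform B u w) <= 0.
      by rewrite pmulr_rle0// mulr_ge0_le0// ltW.
    have : t * (t * bform B w w) <= 0.
      by rewrite !mulr_ge0_le0.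
    lra.
  split; last exact: ltW.
  by move=> ker; move: neg; rewrite ker ltxx.
- apply: connected_continuous_connected; first exact: segment_connected.
  exact: continuous_subspaceT.
Qed.

(** Otherwise, by connectedness, [bform B u] would vanish at some causal vector of the component,
    against [bform_timelike_neq0]. *)
Lemma causal_component_neg B u w : B^T = B -> has_index B 1 ->
  bform B u u < 0 ->
  connected_component
    [set v | ~ (forall z, bform B v z = 0) /\ bform B v v <= 0] u w ->
  bform B u w < 0.
Proof.
move=> BT ind uu [C [Cu Csub Cc] Cw].
have cf : continuous (fun v => bform B u v).
  move=> v; apply: (@cvg_bform _ (nbhs v) _ (fun=> B) (fun=> u) id);
    [exact: cvg_cst|exact: cvg_cst|exact: cvg_id].
have /connected_intervalP itv : connected (bform B u @` C).
  by apply: connected_continuous_connected => //; exact: continuous_subspaceT.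
rewrite ltNge; apply/negP => uw.
have [v Cv v0] : (bform B u @` C) 0.
  apply: (itv (bform B u u) (bform B u w)); [by exists u|by exists w|].
  by rewrite uw ltW.
have [vk vv] := Csub _ Cv.
exact: (bform_timelike_neq0 B u v).
Qed.

End Forms.

(** * Porosity and null sets *)

Section NullSets.
Context {R : realType} {n : nat}.
Implicit Types (p v x : 'rV[R]_n) (Z : set 'rV[R]_n).

Definition cube p (l : R) : set 'rV[R]_n :=
  [set x | forall i, p 0 i <= x 0 i < p 0 i + l].

(** A form of content zero: for each [e] the cover is one finite list of cubes of equal side, which
    is what iterated subdivision produces. *)
Definition cube_null Z : Prop :=
  forall e : R, 0 < e -> exists (s : seq 'rV[R]_n) (l : R),
    [/\ 0 <= l, forall x, Z x -> exists2 p, p \in s & cube p l x &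
        (size s)%:R * l ^+ n <= e].

Lemma rV_norm_le x (e : R) : 0 <= e -> (forall i, `|x 0 i| <= e) -> `|x| <= e.
Proof.
move=> e0 xe; rewrite /Num.norm/= mx_normrE; apply: bigmax_le => // -[i j] _ /=.
by rewrite ord1.
Qed.

Lemma norm_coord_le x i : `|x 0 i| <= `|x|.
Proof.
rewrite [leRHS]/Num.norm/= mx_normrE.
exact: (le_bigmax _ (fun ij : 'I_1 * 'I_n => `|x ij.1 ij.2|) (0, i)).
Qed.

Lemma lebesgue_null_bigcup (Z : nat -> set 'rV[R]_n) Y : (0 < n)%N ->
  (forall k, cube_null (Z k)) -> Y `<=` \bigcup_k Z k -> lebesgue_null Y.
Proof.
move=> n0 Z0 YZ e e0.
have ek k : 0 < e / (2 ^ k.+1)%:R by rewrite divr_gt0// ltr0n expn_gt0.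
have /choice[sl slP] : forall k, exists sl : seq 'rV[R]_n * R,
    [/\ 0 <= sl.2, forall x, Z k x -> exists2 p, p \in sl.1 & cube p sl.2 x &
        (size sl.1)%:R * sl.2 ^+ n <= e / (2 ^ k.+1)%:R].
  by move=> k; have [s [l H]] := Z0 k _ (ek k); exists (s, l).
have /card_esym/card_set_bijP[h hbij] := card_nat2.
(* Each finite list is padded to a sequence by cubes of side 0, whose volume [0 ^+ n] vanishes
   because [0 < n]. *)
pose side (kj : nat * nat) : R :=
  if (kj.2 < size (sl kj.1).1)%N then (sl kj.1).2 else 0.
pose corner (kj : nat * nat) := nth 0 (sl kj.1).1 kj.2.
have side0 kj : 0 <= side kj.
  by rewrite /side; case: ifP => // _; have [] := slP kj.1.
have vol m : box_volume (corner (h m)) (corner (h m) + const_mx (side (h m))) =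
    side (h m) ^+ n.
  rewrite /box_volume (eq_bigr (fun=> side (h m))); last first.
    by move=> i _; rewrite !mxE addrAC subrr add0r.
  by rewrite prodr_const card_ord.
exists (fun m => corner (h m)),
  (fun m => corner (h m) + const_mx (side (h m))); split.
- by move=> k i; rewrite !mxE lerDl.
- move=> x /YZ[k _ Zx]; have [_ /(_ _ Zx)[p ps px] _] := slP k.
  have [_ _ /(_ (k, index p (sl k).1) Logic.I)[m _ hm]] := hbij.
  exists m => // i; rewrite hm /corner /side /= index_mem ps nth_index// !mxE.
  by have /andP[-> /ltW ->] := px i.
- under eq_eseriesr do rewrite vol.
  rewrite nneseries_esumT; last by move=> m; rewrite lee_fin exprn_ge0.
  rewrite -(reindex_esum _ _ h (fun kj => (side kj ^+ n)%:E) hbij).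
  have -> : [set: nat * nat] = [set: nat] `*`` (fun=> [set: nat]).
    by apply/seteqP; split.
  rewrite -(@esum_esum _ _ _ setT (fun=> setT)
    (fun k j => (side (k, j) ^+ n)%:E)); last first.
    by move=> k j _ _; rewrite lee_fin exprn_ge0.
  apply: (@le_trans _ _ (\esum_(k in [set: nat]) (e / (2 ^ k.+1)%:R)%:E)).
    apply: le_esum => k _; have [l0 _ sk] := slP k.
    apply: (@le_trans _ _ ((size (sl k).1)%:R * (sl k).2 ^+ n)%:E);
      last by rewrite lee_fin.
    rewrite (eq_esum (b := fun j => if j \in `I_(size (sl k).1) then
      ((sl k).2 ^+ n)%:E else 0%E)); last first.
      move=> j _; rewrite /side /=; case: ifPn => jl.
        by rewrite ifT// inE.
      rewrite expr0n gtn_eqF// ifF//.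
      by apply/negP; rewrite inE/= => jl'; rewrite jl' in jl.
    rewrite -esum_mkcond esum_fset; last 2 first.
      exact: finite_II.
      by move=> j _; rewrite lee_fin exprn_ge0.
    rewrite -(@fsbig_ord _ _ _ _ (fun=> ((sl k).2 ^+ n)%:E)) sumEFin lee_fin.
    by rewrite sumr_const card_ord mulr_natl.
  rewrite -nneseries_esumT; last by move=> m; rewrite lee_fin ltW.
  by apply: epsilon_trick0; exact: ltW.
Qed.

(** [N] is chosen before the cube, so that the same fraction of the volume is removed at every
    scale. *)
Lemma cone_free_subdivision v (e : R) Z : 0 < e -> `|v| <= 1 / 2 ->
  (forall z z' t, Z z -> Z z' -> 0 < t -> ~ `|z' - z - t *: v| < t * e) ->
  exists2 N, (0 < N)%N & forall p l, 0 < l ->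
    exists2 s : seq 'rV[R]_n, (size s <= (N ^ n).-1)%N &
      forall x, Z x -> cube p l x -> exists2 q, q \in s & cube q (l / N%:R) x.
Proof.
move=> e0 v12 Zfree; pose N := (Num.trunc (2 / e)).+1.
have N0 : 0 < N%:R :> R by rewrite ltr0n.
exists N => // p l l0.
pose corner (k : {ffun 'I_n -> 'I_N}) : 'rV[R]_n :=
  \row_i (p 0 i + l / N%:R * (k i)%:R).
have vN i : - N%:R * v 0 i < N%:R /\ N%:R * v 0 i < N%:R.
  have /andP[] : - (1 / 2) <= v 0 i <= 1 / 2.
    by rewrite -ler_norml; exact: le_trans (norm_coord_le _ _) v12.
  by split; nra.
(* Every difference of a point of the second cube and a point of the first one
   lies in the open cone around v. *)
pose k1 : {ffun 'I_n -> 'I_N} := [ffun i => inord (Num.trunc (- N%:R * v 0 i))].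
pose k2 : {ffun 'I_n -> 'I_N} := [ffun i => inord (Num.trunc (N%:R * v 0 i))].
have [k0 k0P] : exists k0, forall x, Z x -> ~ cube (corner k0) (l / N%:R) x.
  apply: contrapT => /forallNP H.
  have [x1 [Zx1 x1P]] : exists x, Z x /\ cube (corner k1) (l / N%:R) x.
    apply: contrapT => H1; apply: (H k1) => x Zx cx; apply: H1; by exists x.
  have [x2 [Zx2 x2P]] : exists x, Z x /\ cube (corner k2) (l / N%:R) x.
    apply: contrapT => H2; apply: (H k2) => x Zx cx; apply: H2; by exists x.
  apply: (Zfree _ _ l Zx1 Zx2 l0).
  have lN : 0 < l / N%:R by rewrite divr_gt0.
  (* In each coordinate, one small side bounds the error due to the positions inside the two cubes,
     and another the error of rounding [N%:R * v 0 i]. *)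
  apply: (@le_lt_trans _ _ (l / N%:R * 2)).
    apply: rV_norm_le => [|i]; first by rewrite mulr_ge0// ltW.
    have := x1P i; have := x2P i; rewrite !mxE !ffunE.
    have [v1 v2] := vN i.
    have tr (r : R) : r < N%:R -> (Num.trunc r < N)%N.
      have [r0|r0] := leP 0 r; first by rewrite truncn_lt_nat.
      by move=> _; rewrite truncn_floor leNgt r0.
    rewrite !inordK ?tr//.
    have -> : l * v 0 i = l / N%:R * (N%:R * v 0 i).
      by rewrite mulrA divfK// gt_eqF.
    rewrite mulNr in v1 *.
    set r := N%:R * v 0 i in v1 v2 *; set d := l / N%:R in lN *.
    set y1 := x1 0 i; set y2 := x2 0 i.
    (* [Num.trunc] is 0 on negative reals, so at least one of the two truncations vanishes and the
       other rounds [r] or [- r]. *)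
    have key : `|(Num.trunc r)%:R - (Num.trunc (- r))%:R - r| <= 1.
      have [r0|r0] := leP 0 r.
        have -> : Num.trunc (- r) = 0%N.
          apply/truncn0Pn; rewrite -ltNge; lra.
        have /andP[] := truncn_itv r0; rewrite -natr1 ler_norml; lra.
      have -> : Num.trunc r = 0%N.
        apply/truncn0Pn; rewrite -ltNge; lra.
      have r0' : 0 <= - r by lra.
      have /andP[] := truncn_itv r0'; rewrite -natr1 ler_norml; lra.
    move: key; rewrite !ler_norml => /andP[key1 key2] /andP[a1 a2] /andP[b1 b2].
    by nra.
  have : 2 / e < N%:R by exact: truncnS_gt.
  rewrite ltr_pdivrMr// => H2.
  by rewrite -mulrA ltr_pM2l// mulrC ltr_pdivrMr// mulrC.
exists [seq corner k | k in predC1 k0].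
  by rewrite size_image cardC1 card_ffun !card_ord.
move=> x Zx xl.
pose c i := N%:R * (x 0 i - p 0 i) / l.
have c0 i : 0 <= c i.
  have /andP[xi _] := xl i.
  by rewrite /c divr_ge0 ?mulr_ge0 ?subr_ge0// ltW.
have cN i : c i < N%:R.
  have /andP[_ xi] := xl i.
  by rewrite /c ltr_pdivrMr// ltr_pM2l// ltrBlDl.
pose k : {ffun 'I_n -> 'I_N} := [ffun i => inord (Num.trunc (c i))].
have kP : cube (corner k) (l / N%:R) x.
  move=> i; rewrite !mxE ffunE inordK; last by rewrite truncn_lt_nat.
  have /andP[t1 t2] := truncn_itv (c0 i).
  have -> : x 0 i = p 0 i + l / N%:R * c i.
    rewrite /c; field; rewrite !gt_eqF//.
  rewrite lerD2l ler_pM2l ?divr_gt0// t1 /= -addrA ltrD2l.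
  by rewrite -[X in _ + X]mulr1 -mulrDr natr1 ltr_pM2l// divr_gt0.
exists (corner k) => //; apply: map_f; rewrite mem_enum.
by apply/eqP => kk0; apply: (k0P x Zx); rewrite -kk0.
Qed.

(** After [m] subdivisions at most [(N ^ n - 1) ^ m] cubes of side [l / N ^ m] remain. Their total
    volume is at most [r ^ m * l ^ n] with [r < 1], which tends to 0. *)
Lemma cone_free_cube_null v (e : R) Z p l : 0 < e -> 0 < l ->
  Z `<=` cube p l ->
  (forall z z' t, Z z -> Z z' -> 0 < t -> ~ `|z' - z - t *: v| < t * e) ->
  cube_null Z.
Proof.
move=> e0 l0 Zp Zfree.
(* Scaling [v] and [e] by [c] leaves the cone unchanged up to rescaling [t], and brings the norm of
   [v] below [1 / 2]. *)
pose c := (2 * (1 + `|v|))^-1.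
have v1 : 0 < 1 + `|v| by rewrite ltr_pwDl.
have c0 : 0 < c by rewrite invr_gt0 mulr_gt0.
have [N N0 NP] : exists2 N, (0 < N)%N & forall p l, 0 < l ->
    exists2 s : seq 'rV[R]_n, (size s <= (N ^ n).-1)%N &
      forall x, Z x -> cube p l x -> exists2 q, q \in s & cube q (l / N%:R) x.
  apply: (@cone_free_subdivision (c *: v) (c * e)).
  - by rewrite mulr_gt0.
  - rewrite normrZ (gtr0_norm c0) /c mulrC ler_pdivrMr ?mulr_gt0//.
    lra.
  - move=> z z' t Zz Zz' t0; rewrite scalerA mulrA; apply: Zfree => //.
    exact: mulr_gt0.
have N0' : 0 < N%:R :> R by rewrite ltr0n.
have iter m : exists2 s : seq 'rV[R]_n, (size s <= (N ^ n).-1 ^ m)%N &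
    forall x, Z x -> exists2 q, q \in s & cube q (l / N%:R ^+ m) x.
  elim: m => [|m [s ss sP]].
    exists [:: p] => // x Zx; exists p; first by rewrite inE.
    by rewrite expr0 divr1; exact: Zp.
  have lm : 0 < l / N%:R ^+ m by rewrite divr_gt0// exprn_gt0.
  have /choice[sub subP] : forall q, exists sub : seq 'rV[R]_n,
      (size sub <= (N ^ n).-1)%N /\ forall x, Z x -> cube q (l / N%:R ^+ m) x ->
        exists2 q', q' \in sub & cube q' (l / N%:R ^+ m / N%:R) x.
    by move=> q; have [t st tP] := NP q _ lm; exists t.
  exists (flatten [seq sub q | q <- s]).
    rewrite size_flatten /shape -map_comp sumnE big_map.
    apply: (@leq_trans (\sum_(q <- s) (N ^ n).-1)%N).
      by apply: leq_sum => q _; have [] := subP q.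
    by rewrite big_const_seq count_predT iter_addn_0 expnS leq_mul2l ss orbT.
  move=> x Zx; have [q qs qx] := sP x Zx.
  have [_ /(_ x Zx qx)[q' q's q'x]] := subP q.
  exists q'; last by rewrite exprSr invfM mulrA.
  by apply/flatten_mapP; exists q.
move=> d d0; pose r : R := (N ^ n).-1%:R / (N ^ n)%:R.
have Nn0 : (0 < N ^ n)%N by rewrite expn_gt0 N0.
have Nn0' : 0 < (N ^ n)%:R :> R by rewrite ltr0n.
have r1 : `|r| < 1.
  rewrite ger0_norm; last by rewrite divr_ge0.
  by rewrite ltr_pdivrMr// mul1r ltr_nat prednK.
have dl : 0 < d / l ^+ n by rewrite divr_gt0// exprn_gt0.
have [m rm] : exists m, `|r ^+ m| < d / l ^+ n.
  have /cvgrPdist_lt/(_ _ dl)[m _ /(_ m (leqnn m))] := cvg_expr r1.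
  by rewrite /= sub0r normrN; exists m.
have [s ss sP] := iter m.
exists s, (l / N%:R ^+ m); split=> //.
  by rewrite ltW// divr_gt0// exprn_gt0.
have lm : 0 < (l / N%:R ^+ m) ^+ n by rewrite exprn_gt0// divr_gt0// exprn_gt0.
apply: (@le_trans _ _ (((N ^ n).-1 ^ m)%:R * (l / N%:R ^+ m) ^+ n)).
  by rewrite ler_pM2r// ler_nat.
have -> : ((N ^ n).-1 ^ m)%:R * (l / N%:R ^+ m) ^+ n = r ^+ m * l ^+ n.
  rewrite /r !expr_div_n !natrX -!exprM [(m * n)%N]mulnC.
  by rewrite mulrAC mulrA.
rewrite -ler_pdivlMr ?exprn_gt0//; apply/ltW/(le_lt_trans (ler_norm _)).
exact: rm.
Qed.

End NullSets.

(** * Causal paths *)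

Section AffineReparametrization.
Context {R : realType} {V' V W : normedModType R}.
Variables (L : V' -> V) (D : V' -> V).
Hypothesis dL : forall x, differentiable L x.
Hypothesis LD : forall h w x, L (h *: w + x) = h *: D w + L x.

(** By [LD], [L] is affine with linear part [D], so both sides are limits of the same difference
    quotients. It serves for translations of the parameter and for segments in a chart. *)
Lemma derive_comp_affine (f : V -> W) (w x : V') :
  'D_w (f \o L) x = 'D_(D w) f (L x).
Proof.
rewrite /derive.
by under eq_fun do rewrite /= LD.
Qed.

Lemma Ck_comp_affine k (U : set V) (f : V -> W) :
  Ck k U f -> Ck k (L @^-1` U) (f \o L).
Proof.
elim: k f => [|k IH] f /=.
  move=> Uf x Ux; apply: continuous_comp; last exact: Uf.
  exact: differentiable_continuous.
move=> [df Df]; split=> [x Ux|w].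
  by apply: differentiable_comp => //; exact: df.
have -> : 'D_w (f \o L) = 'D_(D w) f \o L.
  by apply/funext => x; exact: derive_comp_affine.
exact/IH/Df.
Qed.

Lemma smooth_on_comp_affine (U : set V) (f : V -> W) :
  smooth_on U f -> smooth_on (L @^-1` U) (f \o L).
Proof. by move=> Uf k; exact: Ck_comp_affine. Qed.

End AffineReparametrization.

Lemma Ck_subset {R : realType} {V W : normedModType R} k (U U' : set V)
    (f : V -> W) : U' `<=` U -> Ck k U f -> Ck k U' f.
Proof.
move=> U'U; elim: k f => [|k IH] f /=; first by move=> Uf x /U'U/Uf.
by move=> [df Df]; split=> [x /U'U/df|w]; last exact/IH/Df.
Qed.

Lemma smooth_on_subset {R : realType} {V W : normedModType R} (U U' : set V)
    (f : V -> W) : U' `<=` U -> smooth_on U f -> smooth_on U' f.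
Proof. by move=> U'U Uf k; exact: Ck_subset (Uf k). Qed.

Section Paths.
Context {R : realType} {n : nat} {M : topologicalType} {A : manifold R n M}.
Implicit Types (fut : M -> set 'rV[R]_n) (al : R -> M).

Lemma future_causal_path_lt fut al a b :
  future_causal_path A fut al a b -> a < b.
Proof. by elim=> [a' b' []|a' b' c' [ab _] _ /(lt_trans ab)]. Qed.

Lemma future_causal_arc_eq fut al al' a b :
  (forall t, a <= t <= b -> al t = al' t) ->
  future_causal_arc A fut al a b -> future_causal_arc A fut al' a b.
Proof.
move=> E [ab [W [be [IW sW bE bfut]]]]; split=> //; exists W, be.
by split=> // t tab; rewrite bE// E.
Qed.

Lemma future_causal_path_eq fut al al' a b :
  (forall t, a <= t <= b -> al t = al' t) ->
  future_causal_path A fut al a b -> future_causal_path A fut al' a b.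
Proof.
move=> E p; elim: p E => {a b}[a b p|a b c p q IH] E.
  by apply: Path_arc; exact: future_causal_arc_eq p.
have ab := future_causal_path_lt _ _ _ _ (Path_arc p).
have bc := future_causal_path_lt _ _ _ _ q.
apply: (@Path_cat _ _ _ _ _ _ a b c).
  apply: future_causal_arc_eq p => t /andP[ta tb]; apply: E.
  by rewrite ta (le_trans tb)// ltW.
by apply: IH => t /andP[tb tc]; apply: E; rewrite tc (le_trans _ tb)// ltW.
Qed.

Lemma future_causal_path_cat fut al a b c :
  future_causal_path A fut al a b -> future_causal_path A fut al b c ->
  future_causal_path A fut al a c.
Proof.
elim=> [a' b' p|a' b' c' p _ IH] q; first exact: Path_cat p q.
exact: Path_cat p (IH q).
Qed.

Lemma future_causal_arc_sub fut al a b a' b' : a <= a' -> a' < b' -> b' <= b ->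
  future_causal_arc A fut al a b -> future_causal_arc A fut al a' b'.
Proof.
move=> aa' ab' bb' [ab [W [be [IW sW bE bfut]]]]; split=> //; exists W, be.
have sub t : a' <= t <= b' -> a <= t <= b.
  by move=> /andP[ta tb]; rewrite (le_trans aa')//= (le_trans tb).
split=> //.
- by move=> t; rewrite /= in_itv/= => /sub tab; apply: IW; rewrite /= in_itv.
- by move=> t /sub; exact: bE.
- by move=> t /sub; exact: bfut.
Qed.

Lemma future_causal_path_sub fut al a b a' b' :
  a <= a' -> a' < b' -> b' <= b ->
  future_causal_path A fut al a b -> future_causal_path A fut al a' b'.
Proof.
move=> aa' ab' bb' p.
elim: p a' b' aa' ab' bb' => {a b}[a b p|a b c p q IH] a' b' aa' ab' bb'.
  by apply: Path_arc; exact: future_causal_arc_sub p.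
have [b'b|bb''] := leP b' b.
  by apply: Path_arc; apply: future_causal_arc_sub p.
have [ba'|a'b] := leP b a'; first exact: IH.
apply: (@Path_cat _ _ _ _ _ _ a' b b'); last exact: IH.
by apply: future_causal_arc_sub p.
Qed.

Lemma future_causal_path_curve fut al a b :
  future_causal_path A fut al a b -> future_causal_curve A fut `[a, b] al.
Proof.
move=> p; split; first exact: interval_is_interval.
move=> a' b' /=; rewrite !in_itv/= => /andP[aa' _] /andP[_ bb'] ab'.
exact: future_causal_path_sub p.
Qed.

Lemma future_causal_path_mono fut fut' al a b :
  (forall x, fut x `<=` fut' x) ->
  future_causal_path A fut al a b -> future_causal_path A fut' al a b.
Proof.
move=> ff'.
have arc a' b' :
    future_causal_arc A fut al a' b' -> future_causal_arc A fut' al a' b'.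
  move=> [ab [W [be [IW sW bE bfut]]]]; split=> //; exists W, be; split=> //.
  by move=> t /bfut/ff'.
elim=> [a' b' /arc|a' b' c' /arc p _]; first exact: Path_arc.
exact: Path_cat.
Qed.

Lemma future_causal_path_shift fut al a b c : future_causal_path A fut al a b ->
  future_causal_path A fut (fun t => al (t + c)) (a - c) (b - c).
Proof.
have sh t a' b' : a' - c <= t <= b' - c -> a' <= t + c <= b'.
  by rewrite lerBlDr lerBrDr.
have ds (x : R) : differentiable (shift c : R -> R) x.
  by apply: differentiableD.
have sc (h w x : R) : shift c (h *: w + x) = h *: w + shift c x.
  by rewrite /= addrA.
have arc a' b' : future_causal_arc A fut al a' b' ->
    future_causal_arc A fut (fun t => al (t + c)) (a' - c) (b' - c).
  move=> [ab [W [be [IW [oW cW sW] bE bfut]]]]; split; first by rewrite ltrD2r.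
  have cs : continuous (shift c : R -> R).
    by move=> x; apply: differentiable_continuous.
  exists (shift c @^-1` W), (be \o shift c); split.
  - by move=> t; rewrite /= in_itv/= => /sh ?; apply: IW; rewrite /= in_itv.
  - split.
    + by apply: open_comp => // x _; exact: cs.
    + by move=> t Wt; apply: continuous_comp; [exact: cs|exact: cW].
    + move=> ch /sW; exact: (@smooth_on_comp_affine _ _ _ _ (shift c) id ds sc).
  - by move=> t /sh; exact: bE.
  - move=> t /sh/bfut; rewrite /velocity.
    by rewrite -(@derive_comp_affine _ _ _ _ (shift c) id sc).
elim=> [a' b' /arc|a' b' c' /arc p _]; first exact: Path_arc.
exact: Path_cat.
Qed.

Definition reach fut (x y : M) : Prop :=
  exists al a b, [/\ future_causal_path A fut al a b, al a = x & al b = y].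

Lemma reach_trans fut x y z : reach fut x y -> reach fut y z -> reach fut x z.
Proof.
move=> [al [a [b [p ax bx]]]] [al' [a' [b' [p' ax' bx']]]].
have ab := future_causal_path_lt _ _ _ _ p.
have ab' := future_causal_path_lt _ _ _ _ p'.
(* The second path is shifted to start at [b]. Both branches take the value [y] there, so [gaE]
   holds at the junction as well. *)
pose ga t := if t <= b then al t else al' (t + (a' - b)).
have gaE t : b <= t -> ga t = al' (t + (a' - b)).
  rewrite /ga le_eqVlt => /predU1P[<-|bt]; last by rewrite leNgt bt.
  by rewrite lexx bx -ax' addrC subrK.
exists ga, a, (b' - (a' - b)); split; last 2 first.
- by rewrite /ga ltW.
- by rewrite gaE ?subrK//; lra.
apply: (@future_causal_path_cat _ _ _ b).
  by apply: future_causal_path_eq p => t /andP[_ tb]; rewrite /ga tb.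
have := future_causal_path_shift _ _ _ _ (a' - b) p'.
rewrite opprB addrCA subrr addr0 => q.
by apply: future_causal_path_eq q => t /andP[bt _]; rewrite gaE.
Qed.

Lemma not_reach_self {q} (F : foliation A q) fut x :
  transversely_causal F fut -> ~ reach fut x x.
Proof.
move=> caus [al [a [b [p ax bx]]]].
have [[l y] [/= lx _]] := leaf_partition F x.
apply: (caus l); exists al, a, b, y, y; split; rewrite ?lx//.
  exact: future_causal_path_lt p.
exact: future_causal_path_curve.
Qed.

End Paths.

(** * Cones in charts *)

Section Charts.
Context {R : realType} {n : nat} {M : topologicalType} {A : manifold R n M}.
Implicit Types (c d : chart R n M) (x : M) (v : 'rV[R]_n).

Lemma chart_image_nbhs c x (N : set M) : cdom c x -> nbhs x N ->
  nbhs (cmap c x) [set z | (cmap c @` cdom c) z /\ N (cinv c z)].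
Proof.
move=> cx Nx; have icx : (cmap c @` cdom c) (cmap c x) by exists x.
apply: filterI; first by apply: open_nbhs_nbhs; split=> //; exact: cimg_open.
have cN : nbhs (cinv c (cmap c x)) N by rewrite cmapK.
exact: (cinv_continuous icx).
Qed.

Lemma chart_preimage_nbhs c x (N : set 'rV[R]_n) : cdom c x ->
  nbhs (cmap c x) N -> nbhs x [set y | cdom c y /\ N (cmap c y)].
Proof.
move=> cx Nx; apply: filterI.
  by apply: open_nbhs_nbhs; split=> //; exact: cdom_open.
exact: (cmap_continuous cx).
Qed.

Lemma transition_differentiable c d x : atlas A c -> atlas A d ->
  cdom c x -> cdom d x -> differentiable (cmap d \o cinv c) (cmap c x).
Proof.
move=> ac ad cx dx; have [+ _] := atlas_smooth ac ad 1.
by apply; exists x.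
Qed.

(** Chain rule, row by row: the composite of the two transition maps is the identity near
    [cmap c x]. *)
Lemma transition_jacobianK c d x : atlas A c -> atlas A d ->
  cdom c x -> cdom d x ->
  'J (cmap d \o cinv c) (cmap c x) *m 'J (cmap c \o cinv d) (cmap d x) = 1%:M.
Proof.
move=> ac ad cx dx.
have dcd := transition_differentiable _ _ _ ac ad cx dx.
have ddc := transition_differentiable _ _ _ ad ac dx cx.
have E : (cmap d \o cinv c) (cmap c x) = cmap d x by rewrite /= cmapK.
apply/row_matrixP => i; rewrite !rowE mulmxA mulmx1 -deriveEjacobian//.
rewrite deriveE// -deriveEjacobian// deriveE// -E -[LHS]/(('d _ _ \o 'd _ _) _).
rewrite -diff_comp ?E// -deriveE; last by apply: differentiable_comp; rewrite ?E.
rewrite -[RHS](derive_id (cmap c x)); apply: near_eq_derive.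
have : nbhs (cmap c x) [set z | (cmap c @` cdom c) z /\ cdom d (cinv c z)].
  apply: chart_image_nbhs => //; apply: open_nbhs_nbhs; split=> //.
  exact: cdom_open.
apply: filterS => _ [[y cy <-]] /=; rewrite cmapK// => dy.
by rewrite cmapK.
Qed.

End Charts.

Section Cones.
Context {R : realType} {n q : nat} {M : topologicalType}.
Context {A : manifold R n M} {F : foliation A q}.
Context {g : M -> 'M[R]_n} {fut : M -> set 'rV[R]_n}.
Hypothesis gT : transverse_lorentzian F g.
Hypothesis futT : time_orientation F g fut.
Implicit Types (c d : chart R n M) (x y : M) (u v w : 'rV[R]_n).

Lemma causal_vectorE x : transversely_causal_vector F g x =
  [set v | ~ (forall z, bform (g x) v z = 0) /\ bform (g x) v v <= 0].
Proof.
have [_ _ _ _ ker] := gT.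
by apply/seteqP; split=> v [vx vv]; split=> // /ker.
Qed.

Lemma futE x w : fut x w -> fut x = connected_component
  [set v | ~ (forall z, bform (g x) v z = 0) /\ bform (g x) v v <= 0] w.
Proof.
have [+ _] := futT => /(_ x)[v _ ->]; rewrite causal_vectorE => vw.
exact: same_connected_component.
Qed.

Lemma fut_timelike_neg x u w :
  fut x u -> fut x w -> bform (g x) u u < 0 -> bform (g x) u w < 0.
Proof.
have [_ sg _ ig _] := gT.
by move=> xu; rewrite (futE _ _ xu) => xw uu; exact: causal_component_neg.
Qed.

(** With [fut_timelike_neg], this turns membership of a timelike vector in the future wedge into the
    sign of its product with one known future vector. *)
Lemma timelike_neg_fut x u w :
  fut x w -> bform (g x) u u < 0 -> bform (g x) u w < 0 -> fut x u.
Proof.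
have [_ sg _ ig _] := gT.
move=> xw uu uw; move: (xw); rewrite (futE _ _ xw).
move=> /connected_component_sub[wk ww].
exact: causal_segment_connected.
Qed.


Lemma vector_inK c (X : M -> 'rV[R]_n) x : atlas A c -> cdom c x ->
  vector_in A c X (cmap c x) *m 'J (cmap (chart_at A x) \o cinv c) (cmap c x) =
  X x.
Proof.
move=> ac cx; rewrite /vector_in cmapK// -mulmxA.
rewrite (@transition_jacobianK _ _ _ A (chart_at A x) c x) ?mulmx1//.
- exact: chart_at_atlas.
- exact: chart_at_dom.
Qed.

(** Near [x] the time orientation is given by a continuous future field [X]. Being timelike and
    having negative product with [X] are strict inequalities between continuous functions of point
    and vector, so they persist nearby, where they imply being future. *)
Lemma fut_chart_open c x v : atlas A c -> cdom c x ->
  let K z := 'J (cmap (chart_at A (cinv c z)) \o cinv c) z in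
  let w := v *m K (cmap c x) in
  fut x w -> bform (g x) w w < 0 ->
  \forall p \near (cmap c x, v), fut (cinv c p.1) (p.2 *m K p.1).
Proof.
move=> ac cx K w xw ww; set z0 := cmap c x.
have ic : (cmap c @` cdom c) z0 by exists x.
have z0x : cinv c z0 = x by exact: cmapK.
have [gs _ _ _ _] := gT.
have cG : {for z0, continuous (tensor_in A c g)} by exact: (gs c ac 0%N).
have [_ /(_ x)[U [X [oU Ux cX XU]]]] := futT.
have cY : {for z0, continuous (vector_in A c X)} by apply: cX => //; exists x.
(* [K z] passes from components in [c] to the preferred chart at the point, which may jump with [z].
   Continuity is therefore argued for the components in [c]. *)
have GE z u u' : bform (tensor_in A c g z) u u' =
    bform (g (cinv c z)) (u *m K z) (u' *m K z).
  exact: bform_pullback.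
have c1 : (fun p : 'rV[R]_n * 'rV[R]_n => p.1) @ (z0, v) --> z0.
  exact: cvg_fst.
have c2 : (fun p : 'rV[R]_n * 'rV[R]_n => p.2) @ (z0, v) --> v.
  exact: cvg_snd.
have h1 : \forall p \near (z0, v), bform (tensor_in A c g p.1) p.2 p.2 < 0.
  apply: (@cvgr_lt _ _ (nbhs (z0, v)) _ _ (bform (tensor_in A c g z0) v v)).
    by apply: cvg_bform => //; apply: (continuous_cvg _ cG).
  by rewrite GE z0x.
have h2 : \forall p \near (z0, v),
    bform (tensor_in A c g p.1) p.2 (vector_in A c X p.1) < 0.
  apply: (@cvgr_lt _ _ (nbhs (z0, v)) _ _
    (bform (tensor_in A c g z0) v (vector_in A c X z0))).
    apply: cvg_bform => //.
      exact: (continuous_cvg _ cG).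
    exact: (continuous_cvg _ cY).
  rewrite GE z0x; apply: fut_timelike_neg => //.
  by rewrite /K z0x vector_inK//; exact: XU.
have h3 : \forall p \near (z0, v), (cmap c @` cdom c) p.1 /\ U (cinv c p.1).
  apply: (c1 [set z | (cmap c @` cdom c) z /\ U (cinv c z)]).
  by apply: chart_image_nbhs => //; exact: open_nbhs_nbhs.
near=> p.
have [[y cy yp] Uy] : (cmap c @` cdom c) p.1 /\ U (cinv c p.1) by near: p.
have py : cinv c p.1 = y by rewrite -yp cmapK.
apply: (@timelike_neg_fut _ _ (X y)); rewrite py.
- by apply: XU; rewrite -py.
- by rewrite -{1}py -GE; near: p.
- have -> : X y = vector_in A c X p.1 *m K p.1.
    by rewrite /K py -yp vector_inK.
  by rewrite -{1}py -GE; near: p.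
Unshelve. all: by end_near. Qed.

(* The segment from z to z' is a future causal curve because its constant
   chart velocity z' - z lies in the cone around v. *)
Lemma local_cone_reach c x v : atlas A c -> cdom c x ->
  let w := v *m 'J (cmap (chart_at A x) \o cinv c) (cmap c x) in
  fut x w -> bform (g x) w w < 0 ->
  exists e d : R, [/\ 0 < e, 0 < d, ball (cmap c x) d `<=` cmap c @` cdom c &
    forall z z' t, ball (cmap c x) d z -> ball (cmap c x) d z' -> 0 < t ->
      `|z' - z - t *: v| < t * e -> reach (A := A) fut (cinv c z) (cinv c z')].
Proof.
move=> ac cx w xw ww; set z0 := cmap c x.
have z0x : cinv c z0 = x by exact: cmapK.
have ic : (cmap c @` cdom c) z0 by exists x.
have := @fut_chart_open c x v ac cx; rewrite /= -/z0 z0x.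
move=> /(_ xw ww)[[P Q] /= [/nbhs_ballP[d1 /= d10 Pd] /nbhs_ballP[e /= e0 Qe]] PQ].
have [d2 d20 d2c] : exists2 d : R, 0 < d & ball z0 d `<=` cmap c @` cdom c.
  by apply/nbhs_ballP; apply: open_nbhs_nbhs; split=> //; exact: cimg_open.
pose d := Num.min d1 d2.
have d0 : 0 < d by rewrite lt_min d10.
have bd1 : ball z0 d `<=` ball z0 d1 by apply: le_ball; rewrite ge_min lexx.
have bd2 : ball z0 d `<=` cmap c @` cdom c.
  by apply: subset_trans d2c; apply: le_ball; rewrite ge_min lexx orbT.
exists e, d; split=> // z z' t zd z'd t0 zz'.
pose u := t^-1 *: (z' - z).
have Qu : Q u.
  apply: Qe; rewrite -ball_normE /= distrC.
  have -> : u - v = t^-1 *: (z' - z - t *: v).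
    by rewrite [RHS]scalerBr scalerA mulVf ?gt_eqF// scale1r.
  by rewrite normrZ gtr0_norm ?invr_gt0// mulrC ltr_pdivrMr// mulrC.
pose L (s : R) : 'rV[R]_n := z + s *: u.
have Lt : L t = z'.
  by rewrite /L /u scalerA divff ?gt_eqF// scale1r addrC subrK.
(* Balls are convex, and [L s] is a convex combination of [z] and [z']. *)
have Lball s : 0 <= s <= t -> ball z0 d (L s).
  move=> /andP[s0 st].
  pose r := s / t.
  have r0 : 0 <= r by rewrite divr_ge0// ltW.
  have r1 : r <= 1 by rewrite ler_pdivrMr// mul1r.
  have -> : L s = (1 - r) *: z + r *: z'.
    by rewrite /L /u scalerA -/r scalerBr scalerBl scale1r addrCA addrC.
  clearbody r; move: zd z'd; rewrite -ball_normE /= => zd z'd.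
  have -> : z0 - ((1 - r) *: z + r *: z') = (1 - r) *: (z0 - z) + r *: (z0 - z').
    by rewrite !scalerBr !scalerBl !scale1r; apply/rowP => i; rewrite !mxE; ring.
  apply: (le_lt_trans (ler_normD _ _)); rewrite !normrZ.
  have r1' : 0 <= 1 - r by rewrite subr_ge0.
  rewrite (ger0_norm r0) (ger0_norm r1').
  have := normr_ge0 (z0 - z); have := normr_ge0 (z0 - z').
  have [->|] := eqVneq r 0; first by lra.
  move=> rn0; have {}r0 : 0 < r by rewrite lt_neqAle eq_sym rn0.
  nra.
have LD (h s s' : R) : L (h *: s + s') = h *: (s *: u) + L s'.
  by rewrite /L scalerDl -scalerA addrCA.
have dL (s : R) : differentiable L s.
  by apply: differentiableD => //; apply: differentiableZl.
have cL : continuous L by move=> s; exact: differentiable_continuous.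
exists (cinv c \o L), 0, t; split; last 2 first.
- by rewrite /L /= scale0r addr0.
- by rewrite /= Lt.
apply: Path_arc; split=> //.
exists (L @^-1` ball z0 d), (cinv c \o L); split=> //.
- split.
  + by apply: open_comp => [s _|]; [exact: cL|exact: ball_open].
  + move=> s /bd2 Ls; apply: continuous_comp; first exact: cL.
    exact: cinv_continuous.
  + move=> ch ach; have := atlas_smooth ac ach.
    move=> /(@smooth_on_comp_affine _ _ _ _ L (fun s => s *: u) dL LD).
    apply: smooth_on_subset => s [/bd2[y cy yL] /=].
    by rewrite -yL cmapK// => dy; exists y.
- move=> s st; have sd := Lball _ st; have [y cy yL] := bd2 _ sd.
  have sy : cinv c (L s) = y by rewrite -yL cmapK.
  have dy := @transition_differentiable _ _ _ A c (chart_at A y) y ac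
    (chart_at_atlas A y) cy (chart_at_dom A y).
  have := PQ (L s, u) (conj (Pd _ (bd1 _ sd)) Qu); rewrite /= sy.
  rewrite /velocity /= sy (_ : cmap _ \o _ = (cmap (chart_at A y) \o cinv c) \o L)//.
  rewrite (@derive_comp_affine _ _ _ _ L (fun s => s *: u) LD) scale1r.
  by rewrite deriveEjacobian// -yL.
Qed.

End Cones.

(** * Series of indicators *)

Section IndicatorSeries.
Context {R : realType} {T : Type} (P : nat -> set T).

Definition indicator_term (x : T) (k : nat) : R := `[<P k x>]%:R * 2^-1 ^+ k.

Definition indicator_series (x : T) : R := limn (series (indicator_term x)).

Lemma indicator_term_ge0 x k : 0 <= indicator_term x k.
Proof. by rewrite mulr_ge0// exprn_ge0// invr_ge0. Qed.

Lemma indicator_term_le x k : indicator_term x k <= 2^-1 ^+ k.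
Proof. by rewrite ler_piMl ?exprn_ge0 ?invr_ge0// lern1 leq_b1. Qed.

Lemma is_cvg_indicator_series x : cvgn (series (indicator_term x)).
Proof.
apply: (@series_le_cvg _ _ (geometric 1 2^-1)) => [k|k|k|].
- exact: indicator_term_ge0.
- by rewrite /= mul1r exprn_ge0// invr_ge0.
- by rewrite /= mul1r indicator_term_le.
- apply: is_cvg_geometric_series.
  by rewrite ger0_norm ?invr_ge0// invf_lt1// ltr1n.
Qed.

(** No term decreases and the term of index [k] grows by [2^-1 ^+ k], a margin that survives the
    passage to the limit. *)
Lemma indicator_series_lt x y : (forall k, P k x -> P k y) ->
  (exists k, P k y /\ ~ P k x) -> indicator_series x < indicator_series y.
Proof.
move=> xy [k [ky kx]].
pose b : R := 2^-1 ^+ k.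
have b0 : 0 < b by rewrite exprn_gt0// invr_gt0.
suff : indicator_series x + b <= indicator_series y.
  by apply: lt_le_trans; rewrite ltrDl.
have le_lim N : series (indicator_term y) N <= indicator_series y.
  apply: nondecreasing_cvgn_le; last exact: is_cvg_indicator_series.
  by apply: nondecreasing_series => i _ _; exact: indicator_term_ge0.
rewrite -lerBrDr; apply: limr_le; first exact: is_cvg_indicator_series.
near=> N.
have kN : (k < N)%N by near: N; exact: nbhs_infty_gt.
rewrite lerBrDr (le_trans _ (le_lim N))// /series /= !big_mkord.
rewrite (bigD1 (Ordinal kN))//= [leRHS](bigD1 (Ordinal kN))//=.
rewrite {1}/indicator_term asboolF// mul0r add0r.
rewrite [indicator_term y k]/indicator_term asboolT// mul1r -/b addrC lerD2r.
apply: ler_sum => i _; rewrite ler_wpM2r ?exprn_ge0 ?invr_ge0// ler_nat.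
have [Pix|nPix] := pselect (P i x); last by rewrite asboolF.
by rewrite asboolT// asboolT//; exact: xy.
Unshelve. all: by end_near. Qed.

(** The terms before [N] agree, and the geometric tail from [N] on sums to at most
    [2 * 2^-1 ^+ N]. *)
Lemma indicator_series_close x y N : (forall k, (k < N)%N -> P k x <-> P k y) ->
  indicator_series y <= indicator_series x + 2 * 2^-1 ^+ N.
Proof.
move=> xy; apply: limr_le; first exact: is_cvg_indicator_series.
apply: nearW => m.
have le_lim : series (indicator_term x) m <= indicator_series x.
  apply: nondecreasing_cvgn_le; last exact: is_cvg_indicator_series.
  by apply: nondecreasing_series => i _ _; exact: indicator_term_ge0.
apply: le_trans (lerD le_lim (lexx _)).
(* The exact partial tail makes the induction go through; [maxn] makes it 0 as long as [m <= N]. *)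
suff : series (indicator_term y) m <=
    series (indicator_term x) m + 2 * (2^-1 ^+ N - 2^-1 ^+ maxn m N).
  move=> /le_trans; apply; rewrite lerD2l ler_pM2l// gerBl.
  by rewrite exprn_ge0// invr_ge0.
elim: m {le_lim} => [|m IH].
  by rewrite /series /= !big_geq// max0n subrr mulr0 addr0.
rewrite /series /= !big_nat_recr//= -/(series _ m) -/(series _ m).
have [mN|Nm] := ltnP m N.
  have -> : indicator_term y m = indicator_term x m.
    by rewrite /indicator_term (propext (xy m mN)).
  move: IH; rewrite /series /= (maxn_idPr (ltnW mN)) (maxn_idPr mN); lra.
have := indicator_term_le y m; have := indicator_term_ge0 x m.
move: IH; rewrite /series /= (maxn_idPl Nm) (maxn_idPl (leqW Nm)) exprS; lra.
Qed.

End IndicatorSeries.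

(** Finitely many memberships are constant near [x], and the remaining tail is uniformly small. *)
Lemma indicator_series_continuous {R : realType} {T : topologicalType}
    (P : nat -> set T) x :
  (forall k, nbhs x (P k) \/ nbhs x (~` P k)) ->
  {for x, continuous (@indicator_series R T P)}.
Proof.
move=> Px.
have stable k : \forall y \near x, P k x <-> P k y.
  have [Pk|Pk] := Px k.
    by have px := nbhs_singleton Pk; apply: filterS Pk => y Py; split.
  by have nx := nbhs_singleton Pk; apply: filterS Pk => y Py; split.
have stableN N : \forall y \near x, forall k, (k < N)%N -> P k x <-> P k y.
  elim: N => [|N IH]; first exact: nearW.
  apply: filterS2 IH (stable N) => y IH yN k.
  by rewrite ltnS leq_eqVlt => /predU1P[->|/IH].
apply/cvgrPdist_lt => e e0.
have [N Ne] : exists N, 2 * 2^-1 ^+ N < e.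
  have e2 : 0 < e / 2 by rewrite divr_gt0.
  have h1 : `|2^-1 : R| < 1 by rewrite ger0_norm ?invr_ge0// invf_lt1// ltr1n.
  have /cvgrPdist_lt/(_ _ e2)[N _ /(_ N (leqnn N))] := cvg_expr h1.
  rewrite /= sub0r normrN => NP; exists N.
  by rewrite mulrC -ltr_pdivlMr//; exact: le_lt_trans (ler_norm _) NP.
apply: filterS (stableN N) => y xy.
apply: le_lt_trans Ne; rewrite ler_norml.
have := @indicator_series_close R _ P _ _ _ xy.
have := @indicator_series_close R _ P y x N (fun k kN => iff_sym (xy k kN)).
lra.
Qed.

(** * The time function *)

Definition frontier {T : topologicalType} (P : set T) : set T :=
  [set x | ~ nbhs x P /\ ~ nbhs x (~` P)].

Section StableCausality.
Context {R : realType} {n q : nat} {M : topologicalType}.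
Context {A : manifold R n M} {F : foliation A q}.
Context {g g' : M -> 'M[R]_n} {fut fut' : M -> set 'rV[R]_n}.
Hypothesis gT : transverse_lorentzian F g.
Hypothesis futT : time_orientation F g fut.
Hypothesis gT' : transverse_lorentzian F g'.
Hypothesis futT' : time_orientation F g' fut'.
Hypothesis gg' : metric_lt F g g'.
Hypothesis futfut' : forall x, fut x `<=` fut' x.
Implicit Types (c d : chart R n M) (x y : M).

Let reach' := reach (A := A) fut'.

Lemma fut_timelike x v : fut x v -> bform (g' x) v v < 0.
Proof.
have [+ _] := futT => /(_ x)[w _ ->] /connected_component_sub[vx vv].
exact: gg'.
Qed.

Lemma fut_nonempty x : exists v, fut x v.
Proof.
have [+ _] := futT => /(_ x)[w wx ->]; exists w.
exact: connected_component_refl.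
Qed.

Lemma chart_cone_reach c x v : atlas A c -> cdom c x ->
  fut x (v *m 'J (cmap (chart_at A x) \o cinv c) (cmap c x)) ->
  exists e d : R, [/\ 0 < e, 0 < d, ball (cmap c x) d `<=` cmap c @` cdom c &
    forall z z' t, ball (cmap c x) d z -> ball (cmap c x) d z' -> 0 < t ->
      `|z' - z - t *: v| < t * e -> reach' (cinv c z) (cinv c z')].
Proof.
move=> ac cx xv.
apply: (local_cone_reach gT' futT') => //; first exact: futfut'.
exact: fut_timelike.
Qed.

Lemma chart_jacobian_id x :
  'J (cmap (chart_at A x) \o cinv (chart_at A x)) (cmap (chart_at A x) x) = 1%:M.
Proof.
set c := chart_at A x.
have ac : atlas A c by exact: chart_at_atlas.
have cx : cdom c x by exact: chart_at_dom.
apply/row_matrixP => i; rewrite !rowE mulmx1 -deriveEjacobian; last first.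
  exact: (transition_differentiable _ _ _ ac ac cx cx).
rewrite -[RHS](derive_id (cmap c x)); apply: near_eq_derive.
have /open_nbhs_nbhs : open_nbhs (cmap c x) (cmap c @` cdom c).
  by split; [exact: cimg_open|exists x].
by apply: filterS => _ [y cy <-] /=; rewrite cmapK.
Qed.

(** The initial velocity is timelike for [g'], so in a chart a whole cone around it consists of
    reachable directions. The midpoint of the chord to a slightly later point of the path then has a
    neighborhood in the future of the start and in the past of that later point. *)
Lemma future_causal_path_between al t s : future_causal_path A fut al t s ->
  exists (m : M) (O : set M), nbhs m O /\
    forall y, O y -> reach' (al t) y /\ reach' y (al s).
Proof.
move=> p.
(* Only the first smooth arc is kept; its extension [be] has a two-sided derivative at [t]. *)
have [b [bs [tb [W [be [IW [oW cW sW] bE bfut]]]]]] :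
    exists b, b <= s /\ future_causal_arc A fut al t b.
  case: p => [a b p|a b c p r]; first by exists b.
  by exists b; split=> //; apply/ltW/(future_causal_path_lt _ _ _ _ r).
have tt : t <= t <= b by rewrite lexx ltW.
have Wt : W t by apply: IW; rewrite /= in_itv.
set x := be t; pose c := chart_at A x.
have ac : atlas A c by exact: chart_at_atlas.
have cx : cdom c x by exact: chart_at_dom.
pose v := velocity A be t.
have [|e [d [e0 d0 dc cone]]] := @chart_cone_reach c x v ac cx.
  by rewrite chart_jacobian_id mulmx1; exact: bfut.
set z0 := cmap c x in dc cone.
have z0x : cinv c z0 = x by exact: cmapK.
pose ga := cmap c \o be.
have dga : derivable ga t 1.
  apply: diff_derivable; have [+ _] := sW c ac 1; exact.
have cbe : {for t, continuous be} by exact: cW.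
have cga : {for t, continuous ga}.
  by apply: continuous_comp => //; exact: cmap_continuous.
(* By differentiability at [t], the mean velocity over a short time [h] is within [e / 2] of [v]. *)
have [h [h0 htb cbh bbh wv]] : exists h, [/\ 0 < h, t + h < b,
    cdom c (be (t + h)), ball z0 d (ga (t + h)) &
    `|h^-1 *: (ga (t + h) - z0) - v| < e / 2].
  have e2 : 0 < e / 2 by rewrite divr_gt0.
  have /cvgrPdist_lt/(_ _ e2) := dga.
  have near1 : \forall u \near t, cdom c (be u) /\ ball z0 d (ga u).
    apply: filterI.
      apply: cbe; apply: open_nbhs_nbhs; split=> //; exact: cdom_open.
    by apply: cga; apply: nbhsx_ballx.
  have /nbhs_ballP[r1 /= r10 H1] := near1.
  move=> /nbhs_ballP[r2 /= r20 H2].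
  pose h := Num.min (Num.min r1 r2) (b - t) / 2.
  have m0 : 0 < Num.min (Num.min r1 r2) (b - t).
    by rewrite !lt_min r10 r20 subr_gt0.
  have h0 : 0 < h by rewrite divr_gt0.
  have : h < Num.min (Num.min r1 r2) (b - t) by rewrite /h; lra.
  rewrite !lt_min => /andP[/andP[hr1 hr2] hb].
  have [ch bh] : cdom c (be (t + h)) /\ ball z0 d (ga (t + h)).
    apply: H1; rewrite -ball_normE /= opprD addrA subrr sub0r normrN.
    by rewrite gtr0_norm.
  exists h; split=> //; first by rewrite -ltrBrDl.
  have := H2 h; rewrite -ball_normE /= sub0r normrN gtr0_norm// => /(_ hr2).
  rewrite gt_eqF// => /(_ isT).
  by rewrite distrC -[h *: 1]/(h * 1) mulr1 [h + t]addrC.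
set w := h^-1 *: (ga (t + h) - z0) in wv.
have pE : ga (t + h) = z0 + h *: w.
  by rewrite /w scalerA divff ?gt_eqF// scale1r [RHS]addrC subrK.
clearbody w.
have h2 : 0 < h / 2 by rewrite divr_gt0.
pose mid := z0 + (h / 2) *: w.
have midd : ball z0 d mid.
  move: bbh; rewrite pE /mid -!ball_normE /= !opprD !addrA !subrr !sub0r !normrN.
  rewrite !normrZ !gtr0_norm//; apply: le_lt_trans.
  by rewrite ler_wpM2r//; lra.
have [y0 cy0 y0m] := dc _ midd.
(* On each half of the chord, [r] bounds both the displacement of [y] from [mid] and the deviation
   of [w] from [v]; together they stay below the tolerance [h / 2 * e] of the cone. *)
pose r := h / 2 * (e / 2).
have r0 : 0 < r by rewrite mulr_gt0// divr_gt0.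
exists y0, [set y | cdom c y /\ (ball z0 d (cmap c y) /\ ball mid r (cmap c y))].
split.
  apply: (chart_preimage_nbhs c y0 (ball z0 d `&` ball mid r)) => //.
  apply: filterI; rewrite y0m; last exact: nbhsx_ballx.
  by apply: open_nbhs_nbhs; split=> //; exact: ball_open.
move=> y [cy [yd]]; rewrite -ball_normE /= => yr.
have yK : cinv c (cmap c y) = y by exact: cmapK.
have wvh : `|(h / 2) *: (w - v)| < r by rewrite normrZ gtr0_norm// ltr_pM2l.
have rr : r + r = h / 2 * e by rewrite /r; lra.
have xy : reach' x y.
  rewrite -z0x -yK; apply: (cone _ _ (h / 2)) => //.
    exact: ballxx.
  have -> : cmap c y - z0 - (h / 2) *: v = - (mid - cmap c y) + (h / 2) *: (w - v).
    by rewrite /mid; apply/rowP => i; rewrite !mxE; ring.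
  rewrite -rr; apply: (le_lt_trans (ler_normD _ _)).
  by rewrite normrN ltrD.
have yp : reach' y (be (t + h)).
  rewrite -[X in reach' _ X](cmapK cbh) -yK.
  apply: (cone _ _ (h / 2)) => //.
  rewrite -[cmap c (be _)]/(ga (t + h)) pE.
  have -> : z0 + h *: w - cmap c y - (h / 2) *: v =
      (mid - cmap c y) + (h / 2) *: (w - v).
    by rewrite /mid; apply/rowP => i; rewrite !mxE; field.
  by rewrite -rr; apply: (le_lt_trans (ler_normD _ _)); rewrite ltrD.
rewrite -bE//; split=> //; apply: (reach_trans _ _ _ _ yp).
rewrite bE; last by rewrite lerDl !ltW.
exists al, (t + h), s; split=> //.
apply: future_causal_path_mono futfut' _.
apply: future_causal_path_sub p => //; first by rewrite lerDl ltW.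
exact: lt_le_trans bs.
Qed.

(* Moving two frontier points of P a little, a point of P close to the first
   one reaches a whole neighborhood of the second one as soon as their
   difference lies in the future cone; the second one is then interior. *)
Lemma frontier_cone_free c x : atlas A c -> cdom c x ->
  exists v (e d : R), [/\ 0 < e, 0 < d &
    forall (P : set M), (forall y y', P y -> reach' y y' -> P y') ->
    forall y y' t, cdom c y -> cdom c y' ->
      ball (cmap c x) d (cmap c y) -> ball (cmap c x) d (cmap c y') ->
      frontier P y -> frontier P y' -> 0 < t ->
      ~ `|cmap c y' - cmap c y - t *: v| < t * e].
Proof.
move=> ac cx; have [u xu] := fut_nonempty x.
(* These are the components in the chart [c] of the future vector [u]. *)
pose v := u *m 'J (cmap c \o cinv (chart_at A x)) (cmap (chart_at A x) x).
have [|e [d [e0 d0 dc cone]]] := @chart_cone_reach c x v ac cx.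
  rewrite /v -mulmxA (@transition_jacobianK _ _ _ A (chart_at A x) c) ?mulmx1//.
    exact: chart_at_atlas.
  exact: chart_at_dom.
exists v, e, d; split=> // P Pup y y' t cy cy' yd y'd [_ Py] [Py' _] t0 near_v.
set z := cmap c y in yd near_v; set z' := cmap c y' in y'd near_v.
(* Half of the slack in the cone inequality, since both endpoints are going to move. *)
pose r := (t * e - `|z' - z - t *: v|) / 2.
have r0 : 0 < r by rewrite divr_gt0// subr_gt0.
have chart_nbhs y1 : cdom c y1 -> ball (cmap c x) d (cmap c y1) ->
    nbhs y1 [set y2 | cdom c y2 /\ (ball (cmap c x) d (cmap c y2) /\
      ball (cmap c y1) r (cmap c y2))].
  move=> cy1 y1d.
  apply: (chart_preimage_nbhs c y1
    (ball (cmap c x) d `&` ball (cmap c y1) r)) => //.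
  apply: filterI; last exact: nbhsx_ballx.
  by apply: open_nbhs_nbhs; split=> //; exact: ball_open.
have [y1 [Py1 [cy1 [y1d y1r]]]] : exists y1, P y1 /\ (cdom c y1 /\
    (ball (cmap c x) d (cmap c y1) /\ ball z r (cmap c y1))).
  (* Since [y] is not interior to the complement, [P] meets every neighborhood of [y]. *)
  apply: contrapT => /forallNP H; apply: Py.
  by apply: filterS (chart_nbhs _ cy yd) => y1 Ny1 Py1; exact: (H y1).
apply: Py'; apply: filterS (chart_nbhs _ cy' y'd) => y2 [cy2 [y2d y2r]].
apply: Pup Py1 _; rewrite -(cmapK cy1) -(cmapK cy2); apply: (cone _ _ t) => //.
move: y1r y2r; rewrite -!ball_normE /= -/z -/z' => y1r y2r.
have -> : cmap c y2 - cmap c y1 - t *: v =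
    (z' - z - t *: v) + ((z - cmap c y1) - (z' - cmap c y2)).
  by apply/rowP => i; rewrite !mxE; ring.
apply: (le_lt_trans (ler_normD _ _)).
have := ler_normB (z - cmap c y1) (z' - cmap c y2).
move: y1r y2r; rewrite /r; lra.
Qed.

(** The cone condition is only local, so the frontiers are cut along a countable basis into
    countably many pieces, each inside one set where the condition holds. *)
Lemma measure_zero_frontiers (P : nat -> set M) (Z : set M) : (0 < n)%N ->
  (forall k y y', P k y -> reach' y y' -> P k y') ->
  Z `<=` \bigcup_k frontier (P k) -> measure_zero A Z.
Proof.
move=> n0 Pup ZP c ac.
have [B /countable_injP[phi phiI] [oB nB]] := manifold_second_countable A.
pose piece (ik : nat * nat) : set 'rV[R]_n := cmap c @` (cdom c `&`
  ([set y | exists2 U, B U & phi U = ik.1 /\ U y] `&` frontier (P ik.2))).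
(* Basic sets too large for the local argument may give pieces not known to be null. Those that are
   not null are replaced by the empty set; the null ones still cover, because every point has a
   small enough basic neighborhood. *)
pose piece' m := if @unpickle (nat * nat)%type m is Some ik then
  [set z | cube_null (piece ik) /\ piece ik z] else set0.
have null0 : cube_null (set0 : set 'rV[R]_n).
  by move=> e e0; exists [::], 0; split=> //; rewrite mul0r ltW.
apply: (lebesgue_null_bigcup piece') => // [m|].
  rewrite /piece'; case: (unpickle m) => // ik.
  have [nik|nik] := pselect (cube_null (piece ik)).
    move=> e e0; have [s [l [l0 sP sl]]] := nik e e0.
    by exists s, l; split=> // x [_ /sP].
  rewrite (_ : [set _ | _] = set0)//; apply/seteqP; split=> // z [].
  by move=> /nik.
move=> _ [x [cx Zx] <-]; have [k _ Pkx] := ZP _ Zx.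
have [v [e [d [e0 d0 free]]]] := frontier_cone_free _ _ ac cx.
have [U [BU Ux] Ud] : exists2 U, (B U /\ U x) &
    U `<=` [set y | ball (cmap c x) d (cmap c y)].
  apply: (nB x [set y | ball (cmap c x) d (cmap c y)]).
  have := chart_preimage_nbhs c x (ball (cmap c x) d) cx (nbhsx_ballx _ _ d0).
  by apply: filterS => y [].
exists (pickle (phi U, k)) => //.
rewrite /piece' pickleK /=; split; last first.
  by exists x => //; split=> //; split=> //; exists U.
have UE : [set y | exists2 U', B U' & phi U' = phi U /\ U' y] = U.
  apply/seteqP; split=> [y [U' BU' [+ U'y]]|y Uy]; last by exists U.
  by move=> /phiI <-//; rewrite inE.
rewrite /piece /= UE.
(* For the max norm, a ball of radius [d] lies in the cube of side [d + d] with the same center. *)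
apply: (@cone_free_cube_null _ _ v e _ (cmap c x - const_mx d) (d + d)) => //.
- by rewrite addr_gt0.
- move=> _ [y [cy [Uy _]] <-] i; rewrite !mxE.
  have := Ud _ Uy; rewrite /= -ball_normE /= => yd.
  have := le_lt_trans (norm_coord_le _ i) yd; rewrite !mxE ltr_norml.
  by move=> /andP[]; lra.
- move=> _ _ t [y [cy [Uy Py]] <-] [y' [cy' [Uy' Py']] <-] t0.
  by apply: (free (P k)) => //; [exact: Pup|exact: Ud|exact: Ud].
Qed.

End StableCausality.

Theorem theorem6p1 (R : realType) (n q : nat) (M : topologicalType)
    (A : manifold R n M) (F : foliation A q)
    (g : M -> 'M[R]_n) (fut : M -> set 'rV[R]_n)
    (hn : (3 <= n)%N) (hq : (2 <= q)%N) (hM : connected [set: M])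
    (hg : transverse_lorentzian F g) (hfut : time_orientation F g fut)
    (hstable : transversely_stably_causal F g fut) :
  exists f : M -> R,
    ae_continuous A f /\
    forall (J : set R) (al : R -> M), future_causal_curve A fut J al ->
      forall t s : R, J t -> J s -> t < s -> f (al t) < f (al s).
Proof.
have [g' [fut' [gT' gg' futT' futfut' caus]]] := hstable.
have [B /countable_injP[phi phiI] [oB nB]] := manifold_second_countable A.
(* The injection [phi] numbers the basis; for [k] outside its image the set is empty. *)
pose P k := [set y | exists b, (exists2 U, B U & phi U = k /\ U b) /\
  reach (A := A) fut' b y].
have Pup k y y' : P k y -> reach (A := A) fut' y y' -> P k y'.
  by move=> [b [kb bY]] yy'; exists b; split=> //; exact: reach_trans yy'.
exists (@indicator_series R M P); split.
  apply: (measure_zero_frontiers hfut gT' futT' gg' futfut' P) => //.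
    exact: leq_trans hn.
  move=> x; apply: contra_notP => xP.
  apply: indicator_series_continuous => k.
  have [|nk] := pselect (nbhs x (P k)); first by left.
  have [|nk'] := pselect (nbhs x (~` P k)); first by right.
  by case: xP; exists k.
move=> J al [_ alJ] t s Jt Js ts.
have p := alJ t s Jt Js ts.
apply: indicator_series_lt => [k xk|].
  apply: Pup xk _; exists al, t, s; split=> //.
  exact: future_causal_path_mono p.
have [m [N [mN Oreach]]] :=
  future_causal_path_between hfut gT' futT' gg' futfut' _ _ _ p.
have [U [BU Um] UO] := nB m N mN.
exists (phi U); split.
  by exists m; split; [exists U|have [] := Oreach m (UO _ Um)].
(* If [al t] were in this set, some [b] in [U] would reach [al t]. As [U] lies in the future of
   [al t], [b] would reach itself. *)
move=> [b [[U' BU' [phiU U'b]] bx]].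
have UU' : U' = U by apply: phiI; rewrite ?inE.
have [xb _] := Oreach b (UO _ (eq_ind _ (fun V => V b) U'b _ UU')).
apply: (not_reach_self F fut' b caus).
exact: reach_trans bx xb.
Qed.
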